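(* Let $\mathcal{G}$ be a group prevariety over a finite alphabet $A$ and $\rho:2^{A^*}\to R$ a nice multiplicative rating map. Let $\tau:2^{A^*}\to 2^R$ be the map $K\mapsto\mathcal{I}_{\mathit{SF}(\mathcal{G})}[K,\rho]$. Then $\iota_{\mathcal{G}}[\tau]$ is the least subset of $R$ that is $\mathit{SF}$-complete for $\mathcal{G}$ and $\rho$.
   Context: Fix a finite alphabet $A$. A lattice is a class of languages containing $\emptyset,A^*$, closed under union and intersection. A prevariety is a lattice of regular languages closed under complement and quotients $u^{-1}L=\{w\mid uw\in L\}$, $Lu^{-1}=\{w\mid wu\in L\}$. A group prevariety is a prevariety whose languages are all recognized by morphisms into finite groups. $\mathit{SF}(\mathcal{G})$ is the least class containing $\mathcal{G}$ and all $\{a\}$ ($a\in A$), closed under union, complement and concatenation. A rating algebra is a finite commutative idempotent monoid $(Q,+)$ (neutral element $0_Q$), ordered by $q\le r$ iff $q+r=r$. A rating map is $\tau:2^{A^*}\to Q$ with $\tau(\emptyset)=0_Q$ and $\tau(K_1\cup K_2)=\tau(K_1)+\tau(K_2)$. It is nice if every $K$ has a finite subset $F$ with $\tau(K)=\tau(F)$. It is multiplicative if $Q$ has a multiplication making $(Q,+,\cdot)$ an idempotent semiring and $\tau(\{\varepsilon\})=1_Q$, $\tau(K_1K_2)=\tau(K_1)\tau(K_2)$. Write $\tau(w)=\tau(\{w\})$. In $R$, $\omega$ is a positive integer such that $r^\omega$ is idempotent for every $r$. For a lattice $\mathcal{D}$, a language $L$ and a rating map $\rho$: a $\mathcal{D}$-cover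 of $L$ is a finite set $\mathbf{K}\subseteq\mathcal{D}$ with $L\subseteq\bigcup\mathbf{K}$; its $\rho$-imprint is $\{r\mid\exists K\in\mathbf{K}, r\le\rho(K)\}$; there exists a $\mathcal{D}$-cover of $L$ whose imprint is included in the imprint of every $\mathcal{D}$-cover of $L$, and this imprint is denoted $\mathcal{I}_{\mathcal{D}}[L,\rho]$. The map $\tau$ above is a rating map into $(2^R,\cup)$, ordered by inclusion. For a lattice $\mathcal{G}$ and rating map $\tau:2^{A^*}\to Q$, a $\mathcal{G}$-identity is a language $L\in\mathcal{G}$ with $\varepsilon\in L$; there exists a $\mathcal{G}$-identity $L$ with $\tau(L)\le\tau(L')$ for every $\mathcal{G}$-identity $L'$, and $\iota_{\mathcal{G}}[\tau]$ denotes $\tau(L)$ for any such $L$. For $S\subseteq R$, let $\mu_{\rho,S}:2^{A^*}\to 2^R$ be the nice multiplicative rating map into the idempotent semiring $(2^R,\cup,\cdot)$ (with $XY=\{xy\mid x\in X,y\in Y\}$) determined by $\mu_{\rho,S}(a)=\{s\rho(a)s'\mid s,s'\in S\}$ for $a\in A$; that is, $\mu_{\rho,S}(\varepsilon)=\{1_R\}$, $\mu_{\rho,S}(a_1\cdots a_n)=\mu_{\rho,S}(a_1)\cdots\mu_{\rho,S}(a_n)$ and $\mu_{\rho,S}(K)=\bigcup_{w\in K}\mu_{\rho,S}(w)$. A set $S\subseteq R$ is $\mathit{SF}$-complete for $\mathcal{G}$ and $\rho$ if: (1) $r\in S$ and $q\le r$ imply $q\in S$; (2) $q,r\in S$ imply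 $qr\in S$; (3) $\iota_{\mathcal{G}}[\mu_{\rho,S}]\subseteq S$; (4) $r\in S$ implies $r^\omega+r^{\omega+1}\in S$. *)

(* Defs.v *)
From HB Require Import structures.
From mathcomp Require Import all_boot all_order all_algebra all_fingroup.
From Stdlib Require List.
Set Implicit Arguments.
Unset Strict Implicit.
Unset Printing Implicit Defensive.
Import GRing.Theory.

Definition lang (A : finType) := seq A -> Prop.

Section Languages.
Variable A : finType.

Definition lempty : lang A := fun _ => False.
Definition lfull : lang A := fun _ => True.
Definition lunion (K L : lang A) : lang A := fun w => K w \/ L w.
Definition linter (K L : lang A) : lang A := fun w => K w /\ L w.
Definition lcompl (L : lang A) : lang A := fun w => ~ L w.
Definition lconcat (K L : lang A) : lang A :=
  fun w => exists u v, w = u ++ v /\ K u /\ L v.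
Definition lword (u : seq A) : lang A := fun w => w = u.
Definition lquot_l (u : seq A) (L : lang A) : lang A := fun w => L (u ++ w).
Definition lquot_r (L : lang A) (u : seq A) : lang A := fun w => L (w ++ u).
Definition lsubset (K L : lang A) := forall w, K w -> L w.

Definition regular (L : lang A) : Prop :=
  exists (Q : finType) (q0 : Q) (d : Q -> A -> Q) (F : pred Q),
    forall w, L w <-> F (foldl d q0 w).

(** Recognized by a morphism A^* -> G into a finite group (such a morphism
    is determined by the images of the letters). *)
Definition group_recognized (L : lang A) : Prop :=
  exists (gT : finGroupType) (h : A -> gT) (F : {set gT}),
    forall w, L w <-> (foldl (fun g a => (g * h a)%g) 1%g w \in F).

Definition lattice (C : lang A -> Prop) : Prop :=
  [/\ C lempty, C lfull,
      (forall K L, C K -> C L -> C (lunion K L)) &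
      (forall K L, C K -> C L -> C (linter K L))].

Definition prevariety (C : lang A -> Prop) : Prop :=
  [/\ lattice C,
      (forall L, C L -> regular L),
      (forall L, C L -> C (lcompl L)),
      (forall u L, C L -> C (lquot_l u L)) &
      (forall u L, C L -> C (lquot_r L u))].

Definition group_prevariety (C : lang A -> Prop) : Prop :=
  prevariety C /\ (forall L, C L -> group_recognized L).

Inductive SF (G : lang A -> Prop) : lang A -> Prop :=
| SF_base L : G L -> SF G L
| SF_letter a : SF G (lword [:: a])
| SF_union K L : SF G K -> SF G L -> SF G (lunion K L)
| SF_compl L : SF G L -> SF G (lcompl L)
| SF_concat K L : SF G K -> SF G L -> SF G (lconcat K L).

End Languages.

Section Rating.
Variables (A : finType) (R : finPzSemiRingType).
Local Open Scope ring_scope.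

Definition rle (q r : R) : Prop := q + r = r.

Definition idempotent_add : Prop := forall r : R, r + r = r.

Definition rating_map (rho : lang A -> R) : Prop :=
  rho (@lempty A) = 0 /\ forall K L, rho (lunion K L) = rho K + rho L.

Definition nice_rating (rho : lang A -> R) : Prop :=
  forall K : lang A, exists F : seq (seq A),
    (forall w, w \in F -> K w) /\ rho K = rho (fun w => w \in F).

Definition mult_rating (rho : lang A -> R) : Prop :=
  rho (lword [::]) = 1 /\ forall K L, rho (lconcat K L) = rho K * rho L.

Definition rset := R -> Prop.

Definition is_cover (D : lang A -> Prop) (L : lang A) (Ks : seq (lang A)) :=
  (forall K, List.In K Ks -> D K) /\
  (forall w, L w -> exists K, List.In K Ks /\ K w).

Definition imprint (rho : lang A -> R) (Ks : seq (lang A)) : rset :=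
  fun r => exists K, List.In K Ks /\ rle r (rho K).

(** I_D[L,rho]: the imprint of an optimal D-cover, i.e. the least imprint of
    a D-cover of L; it equals the intersection of the imprints of all
    D-covers of L (an optimal cover exists for any lattice D). *)
Definition opt_imprint (D : lang A -> Prop) (L : lang A) (rho : lang A -> R)
  : rset := fun r => forall Ks, is_cover D L Ks -> imprint rho Ks r.

(** iota_G[tau] for tau valued in (2^R, union): the least value tau(L) over
    G-identities L; it equals the intersection of all such values (an
    optimal G-identity exists when G is a lattice). *)
Definition iota_opt (G : lang A -> Prop) (tau : lang A -> rset) : rset :=
  fun r => forall L, G L -> L [::] -> tau L r.

Definition setmul (X Y : rset) : rset :=
  fun r => exists x y, X x /\ Y y /\ r = x * y.

Definition mu_letter (rho : lang A -> R) (S : rset) (a : A) : rset :=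
  fun r => exists s s', S s /\ S s' /\ r = s * rho (lword [:: a]) * s'.

Fixpoint mu_word (rho : lang A -> R) (S : rset) (w : seq A) : rset :=
  match w with
  | [::] => fun r => r = 1
  | a :: w' => setmul (mu_letter rho S a) (mu_word rho S w')
  end.

Definition mu (rho : lang A -> R) (S : rset) (K : lang A) : rset :=
  fun r => exists w, K w /\ mu_word rho S w r.

(** SF-completeness (omega is a positive integer with r^omega idempotent). *)
Definition SF_complete (G : lang A -> Prop) (rho : lang A -> R) (om : nat)
  (S : rset) : Prop :=
  [/\ (forall q r, S r -> rle q r -> S q),
      (forall q r, S q -> S r -> S (q * r)),
      (forall r, iota_opt G (mu rho S) r -> S r) &
      (forall r, S r -> S (r ^+ om + r ^+ om.+1))].

Definition least_SF_complete (G : lang A -> Prop) (rho : lang A -> R)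
  (om : nat) (S : rset) : Prop :=
  SF_complete G rho om S /\
  forall S', SF_complete G rho om S' -> forall r, S r -> S' r.

End Rating.

(* Main.v *)
(** Soundness: modulo the syntactic kernel of a [G]-identity, closure of the optimal
    imprint under products and under [mu] only uses that imprints are submultiplicative,
    and closure under [r ^+ om + r ^+ om.+1] holds because languages of [SF G] satisfy
    [x w^n y \in K <-> x w^(n+1) y \in K] for [w] in a suitable [G]-identity and [n] large.

    Completeness: given a complete set [S], pick a [G]-identity [L] with [mu L] inside [S]
    and its syntactic group [H]. The values [s0 rho(a1) s1 ... rho(an) sn], graded by the
    image of [a1 ... an] in [H], form a submonoid [T] of [R * H] whose part of degree 1 is
    contained in [S]. Words are covered by induction on the size of an orbit [T d]. If every
    letter acts injectively on [T d], all words of a given degree go into one language.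
    Otherwise a letter [c] shrinks [T d], and words are cut at the occurrences of [c]: the
    factors without [c] are covered by induction on the alphabet, and become the letters of
    a new alphabet acting on the smaller orbit [T (d c)]. *)
Require Import Defs.
From mathcomp Require Import all_boot all_order all_algebra all_fingroup.
From mathcomp Require Import boolp zify cyclic.
From Stdlib Require List.
Set Implicit Arguments.
Unset Strict Implicit.
Unset Printing Implicit Defensive.
Import GRing.Theory.
Local Open Scope ring_scope.

(** * Rating maps *)

Section Order.
Variable R : finPzSemiRingType.
Hypothesis addI : idempotent_add R.

Lemma rle_refl (r : R) : rle r r.
Proof. exact: addI. Qed.

Lemma rle_trans (q r s : R) : rle q r -> rle r s -> rle q s.
Proof. by rewrite /rle => h <-; rewrite addrA h. Qed.

Lemma rle_anti (q r : R) : rle q r -> rle r q -> q = r.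
Proof. by rewrite /rle addrC => h1 h2; rewrite -h2 h1. Qed.

Lemma rle0 (r : R) : rle 0 r.
Proof. exact: add0r. Qed.

Lemma rleDl (q r : R) : rle q (q + r).
Proof. by rewrite /rle addrA addI. Qed.

Lemma rleDr (q r : R) : rle q (r + q).
Proof. by rewrite addrC; exact: rleDl. Qed.

Lemma rle_add (q r s : R) : rle q s -> rle r s -> rle (q + r) s.
Proof. by rewrite /rle => h1 h2; rewrite -addrA h2. Qed.

Lemma rleM (q r q' r' : R) : rle q q' -> rle r r' -> rle (q * r) (q' * r').
Proof.
rewrite /rle => h1 h2; apply: (@rle_trans _ (q' * r)); rewrite /rle.
  by rewrite -mulrDl h1.
by rewrite -mulrDr h2.
Qed.

Lemma rle_sum (I : eqType) (s : seq I) (P : pred I) (F : I -> R) q :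
  (forall i, i \in s -> P i -> rle (F i) q) -> rle (\sum_(i <- s | P i) F i) q.
Proof.
move=> h; rewrite big_seq_cond; elim/big_rec: _ => [|i x /andP[si Pi] IH].
  exact: rle0.
by apply: rle_add => //; exact: h.
Qed.

Lemma rle_sumr (I : eqType) (s : seq I) (P : pred I) (F : I -> R) i :
  i \in s -> P i -> rle (F i) (\sum_(j <- s | P j) F j).
Proof.
elim: s => // j s IH; rewrite inE big_cons => /orP[/eqP <- Pi|si Pi].
  by rewrite Pi; exact: rleDl.
have h := IH si Pi; case: ifP => // _.
by apply: rle_trans h _; exact: rleDr.
Qed.

Lemma idem_exp_mul (r : R) om k :
  r ^+ om * r ^+ om = r ^+ om -> r ^+ (om * k.+1) = r ^+ om.
Proof.
move=> h; elim: k => [|k IH]; first by rewrite muln1.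
by rewrite mulnS exprD IH h.
Qed.

End Order.

Lemma lang_ext (A : finType) (K L : lang A) : (forall w, K w <-> L w) -> K = L.
Proof. by move=> h; apply/predeqP. Qed.

Section RatingTheory.
Variables (A : finType) (R : finPzSemiRingType) (rho : lang A -> R).
Hypotheses (addI : idempotent_add R) (rhoR : rating_map rho).

Lemma rating_mono K L : lsubset K L -> rle (rho K) (rho L).
Proof.
move=> sKL; rewrite /rle -(proj2 rhoR); congr rho.
by apply: lang_ext => w; split=> [[/sKL|]|]; [| |right].
Qed.

Lemma rating_nice_sum K : nice_rating rho -> exists F : seq (seq A),
  (forall w, w \in F -> K w) /\ rho K = \sum_(w <- F) rho (lword w).
Proof.
move=> nice; have [F [sFK ->]] := nice K; exists F; split=> //.
elim: F {sFK} => [|w F IH].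
  rewrite big_nil -(proj1 rhoR); congr rho; exact: lang_ext.
rewrite big_cons -IH -(proj2 rhoR); congr rho.
apply: lang_ext => u; rewrite inE; split=> [/orP[/eqP|]|[->|->]]; rewrite ?eqxx ?orbT //.
  by left.
by right.
Qed.

Lemma rating_le_of_words K q : nice_rating rho ->
  (forall w, K w -> rle (rho (lword w)) q) -> rle (rho K) q.
Proof.
by move=> /(rating_nice_sum K)[F [sFK ->]] h; apply: rle_sum => w /sFK/h.
Qed.

Hypothesis rhoM : mult_rating rho.

Lemma lconcat_word (u v : seq A) : lconcat (lword u) (lword v) = lword (u ++ v).
Proof.
by apply: lang_ext => w; split=> [[_ [_ [-> [-> ->]]]]|->] //; exists u, v.
Qed.

Lemma rating_word_cat (u v : seq A) :
  rho (lword (u ++ v)) = rho (lword u) * rho (lword v).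
Proof. by rewrite -lconcat_word (proj2 rhoM). Qed.

Lemma rating_prod_le K L M : lsubset (lconcat K L) M -> rle (rho K * rho L) (rho M).
Proof. by rewrite -(proj2 rhoM); exact: rating_mono. Qed.

End RatingTheory.

(** * Finite congruences *)

Section Recognition.
Variable A : finType.
Implicit Types (D : lang A -> Prop) (L : lang A).

(** [f] need not be a morphism: its kernel only has to refine the syntactic congruence of [L]. One
    implication suffices because [u] and [v] can be exchanged. *)
Definition finite_index L : Prop :=
  exists (M : finType) (f : seq A -> M), forall u v, f u = f v ->
    forall x y, L (x ++ u ++ y) -> L (x ++ v ++ y).

(** What [G] and [SF G] have in common. Regularity enters as [finite_index], which passes to
    concatenations without automata. *)
Definition quotient_algebra D : Prop :=
  [/\ D (@lfull A), (forall K L, D K -> D L -> D (lunion K L)),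
      (forall L, D L -> D (lcompl L)),
      (forall u L, D L -> D (lquot_l u L) /\ D (lquot_r L u)) &
      (forall L, D L -> finite_index L)].

Definition congruent (M : Type) (f : seq A -> M) : Prop :=
  forall u u' v v', f u = f u' -> f v = f v' -> f (u ++ v) = f (u' ++ v').

(** A quotient of the free monoid whose multiplication is left implicit, with every union of classes
    in [D]. *)
Definition class_map D (M : Type) (f : seq A -> M) : Prop :=
  congruent f /\ forall P : M -> Prop, D (fun w => P (f w)).

Section Boolean.
Variable D : lang A -> Prop.
Hypotheses (DU : forall K L, D K -> D L -> D (lunion K L))
  (DC : forall L, D L -> D (lcompl L)) (DT : D (@lfull A)).

Lemma bool_inter K L : D K -> D L -> D (linter K L).
Proof.
move=> DK DL; rewrite (_ : linter K L = lcompl (lunion (lcompl K) (lcompl L))).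
  by apply: DC; apply: DU; apply: DC.
apply: lang_ext => w; split=> [[kw lw] []//|h]; split; apply: contrapT => n; apply: h.
  by left.
by right.
Qed.

Lemma bool_empty : D (@lempty A).
Proof.
rewrite (_ : @lempty A = lcompl (@lfull A)); first exact: DC.
by apply: lang_ext => w; split=> // /(_ I).
Qed.

Lemma bool_bigU (T : eqType) (s : seq T) (F : T -> lang A) :
  (forall t, t \in s -> D (F t)) -> D (fun w => exists2 t, t \in s & F t w).
Proof.
elim: s => [|t s IH] h.
  rewrite (_ : (fun w => _) = @lempty A); first exact: bool_empty.
  by apply: lang_ext => w; split=> // -[].
rewrite (_ : (fun w => _) = lunion (F t) (fun w => exists2 t, t \in s & F t w)).
  apply: DU; first by apply: h; rewrite mem_head.
  by apply: IH => u us; apply: h; rewrite inE us orbT.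
apply: lang_ext => w; split=> [[u]|[Ft|[u us Fu]]].
- by rewrite inE => /orP[/eqP->|us] Fu; [left|right; exists u].
- by exists t; rewrite ?mem_head.
- by exists u; rewrite // inE us orbT.
Qed.

Lemma bool_bigI (T : eqType) (s : seq T) (F : T -> lang A) :
  (forall t, t \in s -> D (F t)) -> D (fun w => forall t, t \in s -> F t w).
Proof.
move=> h; rewrite (_ : (fun w => _) =
  lcompl (fun w => exists2 t, t \in s & lcompl (F t) w)).
  by apply: DC; apply: bool_bigU => t /h; exact: DC.
apply: lang_ext => w; split=> [hw [t ts]|hw t ts]; first by apply; exact: hw.
by apply: contrapT => n; apply: hw; exists t.
Qed.

End Boolean.

(** * Syntactic congruences *)

Section Syntactic.
Variables (D : lang A -> Prop) (DQ : quotient_algebra D).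

(* The class of [w] is encoded by the set of pairs of context classes accepting [w]. *)
Lemma syntactic_map L : D L -> exists (M : finType) (f : seq A -> M),
  class_map D f /\
  forall u v, f u = f v <-> forall x y, L (x ++ u ++ y) <-> L (x ++ v ++ y).
Proof.
move=> DL; have [DT DU DC Dq Df] := DQ; have [M [f hf]] := Df _ DL.
pose ctx (w : seq A) (p : M * M) :=
  exists x y, f x = p.1 /\ f y = p.2 /\ L (x ++ w ++ y).
pose g (w : seq A) : {set M * M} := [set p | `[< ctx w p >]].
have gE u v : g u = g v <-> forall x y, L (x ++ u ++ y) <-> L (x ++ v ++ y).
  have half u' v' : g u' = g v' -> forall x y, L (x ++ u' ++ y) -> L (x ++ v' ++ y).
    move=> e x y Lxy; have /asboolP : `[< ctx v' (f x, f y) >].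
      by have := in_set (fun p => `[< ctx v' p >]) (f x, f y);
         rewrite -/(g v') -e in_set => <-; apply/asboolP; exists x, y.
    case=> x' [y' [/= ex [ey L']]].
    have L2 := hf _ _ ex [::] (v' ++ y') L'.
    by have := hf _ _ ey (x ++ v') [::]; rewrite !cats0 -!catA; apply.
  split=> [e x y|h]; first by split; apply: half.
  apply/setP=> p; rewrite !in_set; apply: asbool_equiv_eq; split.
    by move=> [x [y [ex [ey Lx]]]]; exists x, y; rewrite -h.
  by move=> [x [y [ex [ey Lx]]]]; exists x, y; rewrite h.
exists {set M * M}, g; split=> //; split.
  move=> u u' v v' /gE eu /gE ev; apply/gE => x y.
  by have := eu x (v ++ y); have := ev (x ++ u') y; rewrite -!catA => -> ->.
move=> P.
(* If both classes of [p] are inhabited, the words with context [p] form a two-sided quotient of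
   [L]; otherwise there are none. *)
have Dctx p : D (fun w => ctx w p).
  have [[x [y [ex ey]]]|no] := pselect (exists x y, f x = p.1 /\ f y = p.2).
    rewrite (_ : (fun w => _) = lquot_r (lquot_l x L) y).
      by apply: (proj2 (Dq _ _ _)); apply: (proj1 (Dq _ _ _)).
    apply: lang_ext => w; rewrite /lquot_r /lquot_l; split=> [|h]; last by exists x, y.
    move=> [x' [y' [ex' [ey' L']]]].
    have L2 := hf _ x (etrans ex' (esym ex)) [::] (w ++ y') L'.
    have := hf _ y (etrans ey' (esym ey)) (x ++ w) [::].
    by rewrite !cats0 -!catA; apply.
  rewrite (_ : (fun w => _) = @lempty A); first exact: bool_empty.
  by apply: lang_ext => w; split=> // -[x [y [ex [ey _]]]]; apply: no; exists x, y.
(* Each class of [g] is a finite Boolean combination of context languages. *)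
rewrite (_ : (fun w => _) = fun w => exists2 m, m \in enum {set M * M} &
   (fun w => P m /\ forall p, p \in enum {: M * M} -> (ctx w p <-> p \in m)) w).
  apply: bool_bigU => // m _.
  have [Pm|nPm] := pselect (P m); last first.
    rewrite (_ : (fun w => _) = @lempty A); first exact: bool_empty.
    by apply: lang_ext => w; split=> // -[].
  rewrite (_ : (fun w => _) =
     fun w => forall p, p \in enum {: M * M} -> (fun w => ctx w p <-> p \in m) w).
    apply: bool_bigI => // p _; case: (boolP (p \in m)) => pm.
      rewrite (_ : (fun w => _) = fun w => ctx w p) //.
      by apply: lang_ext => w; split=> [[_ h]|h]; [apply: h|split].
    rewrite (_ : (fun w => _) = lcompl (fun w => ctx w p)); first exact: DC.
    by apply: lang_ext => w; split=> [[h _] /h|h]; last split.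
  by apply: lang_ext => w; split=> [[]|].
apply: lang_ext => w; split=> [Pw|[m _ [Pm h]]].
  exists (g w); first by rewrite mem_enum.
  by split=> // p _; rewrite in_set; split=> /asboolP.
suff -> : g w = m by [].
apply/setP=> p; rewrite in_set; apply/asboolP/idP => /h; apply; exact: mem_enum.
Qed.

(** Pairing syntactic maps yields one class map that saturates every member of a finite cover. *)
Lemma syntactic_map_seq (Ks : seq (lang A)) : (forall K, List.In K Ks -> D K) ->
  exists (M : finType) (f : seq A -> M), class_map D f /\
  forall K, List.In K Ks -> forall u v, f u = f v -> K u -> K v.
Proof.
have [DT DU DC _ _] := DQ.
elim: Ks => [|K Ks IH] h.
  exists unit, (fun _ => tt); split=> //; split=> // P.
  have [Pt|nPt] := pselect (P tt).
    rewrite (_ : (fun w => _) = @lfull A) //.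
    exact: lang_ext.
  rewrite (_ : (fun w => _) = @lempty A); first exact: bool_empty.
  exact: lang_ext.
have [|M [f [[fc fD] fK]]] := IH; first by move=> K' h'; apply: h; right.
have [M' [f' [[fc' fD'] fK']]] := syntactic_map (h K (or_introl erefl)).
exists (M' * M)%type, (fun w => (f' w, f w)); split; first split.
- by move=> u u' v v' [a b] [c d]; rewrite (fc' _ u' _ v') // (fc _ u' _ v').
- move=> P; rewrite (_ : (fun w => _) = fun w => exists2 m, m \in enum M' &
     linter (fun w => f' w = m) (fun w => P (m, f w)) w).
    apply: bool_bigU => // m _; apply: bool_inter => //.
      exact: (fD' (fun x => x = m)).
    exact: (fD (fun x => P (m, x))).
  apply: lang_ext => w; split=> [Pw|[m _ [-> //]]].
  by exists (f' w); rewrite ?mem_enum.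
- move=> K' [<-|inK] u v [e1 e2]; last exact: fK e2.
  by move/fK': e1 => /(_ [::] [::]); rewrite /= !cats0 => <-.
Qed.

(** [H] is the syntactic class of the empty word. *)
Lemma syntactic_kernel L : D L -> L [::] -> exists H : lang A,
  [/\ D H, H [::], (forall u v, H u -> H v -> H (u ++ v)) &
      forall x u y, H u -> (L (x ++ u ++ y) <-> L (x ++ y))].
Proof.
move=> DL L0; have [M [f [[fc fD] fL]]] := syntactic_map DL.
exists (fun w => f w = f [::]); split=> //.
- exact: (fD (fun x => x = f [::])).
- by move=> u v hu hv; rewrite (fc _ [::] _ [::]).
- by move=> x u y /fL; apply.
Qed.

End Syntactic.
End Recognition.

(** * Star-free closure *)

Section Words.
Variable A : eqType.
Implicit Types (u v w x y : seq A).

Definition wpow n w := flatten (nseq n w).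

Lemma wpowS n w : wpow n.+1 w = w ++ wpow n w.
Proof. by []. Qed.

Lemma wpowD m n w : wpow (m + n) w = wpow m w ++ wpow n w.
Proof. by rewrite /wpow nseqD flatten_cat. Qed.

Lemma size_wpow n w : size (wpow n w) = (n * size w)%N.
Proof. by rewrite /wpow size_flatten /shape map_nseq sumn_nseq mulnC. Qed.

Lemma wpow_nil n : wpow n [::] = [::] :> seq A.
Proof. by apply: size0nil; rewrite size_wpow muln0. Qed.

(** Levi's lemma. *)
Lemma cat_eq_cat u v x y : u ++ v = x ++ y ->
  (exists z, u = x ++ z /\ y = z ++ v) \/ (exists z, x = u ++ z /\ v = z ++ y).
Proof.
elim: u x => [|a u IH] [|b x] /=.
- by move=> ->; left; exists [::].
- by move=> ->; right; exists (b :: x).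
- by move=> <-; left; exists (a :: u).
- case=> -> /IH[[z [-> ->]]|[z [-> ->]]]; [left|right]; by exists z.
Qed.

Lemma wpow_eq_cat n w z z' : wpow n.+1 w = z ++ z' ->
  exists i j w1 w2, [/\ n = (i + j)%N, w = w1 ++ w2, z = wpow i w ++ w1
    & z' = w2 ++ wpow j w].
Proof.
elim: n z => [|n IH] z; rewrite wpowS => /cat_eq_cat[[t [e1 e2]]|[t [e1 e2]]].
- by exists 0%N, 0%N, z, t; split.
- move: e2 => /= /esym/(congr1 size)/= /eqP; rewrite size_cat addn_eq0 !size_eq0.
  move=> /andP[/eqP e2 /eqP e3].
  by exists 0%N, 0%N, w, [::]; rewrite e1 e2 e3 !cats0.
- by exists 0%N, n.+1, z, t; split.
- have [i [j [w1 [w2 [e3 e4 e5 e6]]]]] := IH _ e2.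
  by exists i.+1, j, w1, w2; split; rewrite // ?e3 // e1 e5 wpowS catA.
Qed.

End Words.

Section StarFree.
Variables (A : finType) (G : lang A -> Prop).

Lemma SF_mono (G' : lang A -> Prop) : (forall L, G L -> SF G' L) ->
  forall L, SF G L -> SF G' L.
Proof.
move=> h L; elim=> *; [exact: h|exact: SF_letter|exact: SF_union|exact: SF_compl|].
exact: SF_concat.
Qed.

Hypothesis Gfull : G (@lfull A).

Lemma SF_full : SF G (@lfull A).
Proof. exact: SF_base. Qed.

Lemma SF_inter K L : SF G K -> SF G L -> SF G (linter K L).
Proof. by apply: bool_inter; [exact: SF_union|exact: SF_compl]. Qed.

Lemma SF_empty : SF G (@lempty A).
Proof. by apply: bool_empty; [exact: SF_compl|exact: SF_full]. Qed.

(** Complement of the finite union of the languages [A* b A*] for [b] outside [C]. *)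
Lemma SF_letters (C : pred A) : SF G (fun w => all C w).
Proof.
rewrite (_ : (fun w => _) = lcompl (fun w => exists2 b, b \in enum [predC C] &
  lconcat (lconcat (@lfull A) (lword [:: b])) (@lfull A) w)).
  apply: SF_compl; apply: bool_bigU => [||| b _]; first exact: SF_union.
  - exact: SF_compl.
  - exact: SF_full.
  - by apply: SF_concat; [apply: SF_concat; [exact: SF_full|exact: SF_letter]|exact: SF_full].
apply: lang_ext => w; split.
  move=> /allP hw [b]; rewrite mem_enum inE => nb [p [v [e [[u [b' [ep [_ eb]]]] _]]]].
  by have := hw b; rewrite e ep eb !mem_cat mem_head orbT => /(_ isT)/(negP nb).
move=> h; apply/allP => b bw; apply: contrapT => /negP nb; apply: h.
exists b; first by rewrite mem_enum.
case/splitPr: bw => u v; exists (u ++ [:: b]), v; rewrite -catA; split=> //.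
by split=> //; exists u, [:: b].
Qed.

Lemma SF_eps : SF G (lword [::]).
Proof.
rewrite (_ : lword [::] = fun w => all (pred0 : pred A) w); first exact: SF_letters.
by apply: lang_ext => -[|a w].
Qed.

Lemma SF_if (P : Prop) L : SF G L -> SF G (fun w => P /\ L w).
Proof.
move=> SL; have [p|np] := pselect P.
  by rewrite (_ : (fun w => _) = L) //; apply: lang_ext => w; split=> [[]|].
rewrite (_ : (fun w => _) = @lempty A); first exact: SF_empty.
by apply: lang_ext => w; split=> // -[].
Qed.

(** [cuts w] records the pairs of classes of all factorizations of [w], so a cut inside the middle
    factor [w] can be moved to an equivalent cut of [w']. *)
Lemma finite_index_concat (K L : lang A) :
  finite_index K -> finite_index L -> finite_index (lconcat K L).
Proof.
move=> [M [f hf]] [N [g hg]].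
pose cuts (w : seq A) : {set M * N} :=
  [set p | `[< exists u v, w = u ++ v /\ p = (f u, g v) >]].
exists (M * N * {set M * N})%type, (fun w => (f w, g w, cuts w)).
move=> w w' [efw egw ec] x y [u [v [/esym e [Ku Lv]]]].
case: (cat_eq_cat e) => -[z [ex ey]]; last first.
  exists u, (z ++ w' ++ y); rewrite ex -catA; split=> //; split=> //.
  by apply: hg egw _ _ _; rewrite -ey.
case: (cat_eq_cat (esym ey)) => -[t [ez et]]; last first.
  have /asboolP[u' [v' [ew [eu ev]]]] :
      `[< exists u v, w' = u ++ v /\ (f z, g t) = (f u, g v) >].
    by have := in_set (fun p => `[< exists u v, w' = u ++ v /\ p = (f u, g v) >])
         (f z, g t); rewrite -/(cuts w') -ec in_set => <-; apply/asboolP; exists z, t.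
  exists (x ++ u'), (v' ++ y); rewrite ew -!catA; split=> //; split.
    have := hf _ _ eu x [::]; rewrite !cats0; apply; rewrite -ex //.
  by apply: (hg _ _ ev [::] y); rewrite /= -et.
exists (x ++ w' ++ t), v; rewrite et -!catA; split=> //; split=> //.
by apply: hf efw _ _ _; rewrite -ez -ex.
Qed.

Lemma finite_index_regular (L : lang A) : regular L -> finite_index L.
Proof.
move=> [Q [q0 [d [F hL]]]].
exists {ffun Q -> Q}, (fun w => [ffun q => foldl d q w]) => u v /ffunP e x y.
by rewrite !hL !foldl_cat; have := e (foldl d q0 x); rewrite !ffunE => ->.
Qed.

Hypothesis Gq : quotient_algebra G.

(** Derivatives letter by letter: the quotient of [K L] by [a] is [(a^-1 K) L], together with
    [a^-1 L] when [K] contains the empty word. *)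
Lemma SF_quot_l u (L : lang A) : SF G L -> SF G (lquot_l u L).
Proof.
elim: u L => [|a u IH] L SL //; apply: (IH (lquot_l [:: a] L)) => {u IH}.
elim: SL => {L} [L GL|b|K L SK IK SL IL|L SL IL|K L SK IK SL IL].
- by apply: SF_base; have [_ _ _ Dq _] := Gq; apply: (proj1 (Dq _ _ GL)).
- rewrite (_ : lquot_l _ _ = fun w => a = b /\ lword [::] w).
    by apply: SF_if; exact: SF_eps.
  apply: lang_ext => w; rewrite /lquot_l /lword /=.
  by split=> [[-> ->]|[-> ->]].
- exact: SF_union IK IL.
- exact: SF_compl IL.
rewrite (_ : lquot_l _ _ =
   lunion (lconcat (lquot_l [:: a] K) L) (fun w => K [::] /\ lquot_l [:: a] L w)).
  by apply: SF_union; [exact: SF_concat|exact: SF_if].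
apply: lang_ext => w; split=> [[[|b u] [v [/= e [Ku Lv]]]]|].
- by right; split=> //; rewrite /lquot_l /= e.
- by case: e => eb ew; left; exists u, v; split=> //; rewrite /lquot_l /= eb.
- case=> [[u [v [-> [Ku Lv]]]]|[K0 Lw]]; first by exists (a :: u), v.
  by exists [::], (a :: w).
Qed.

Lemma SF_quot_r u (L : lang A) : SF G L -> SF G (lquot_r L u).
Proof.
elim/last_ind: u L => [|u a IH] L SL.
  by rewrite (_ : lquot_r _ _ = L) //; apply: lang_ext => w; rewrite /lquot_r cats0.
rewrite (_ : lquot_r _ _ = lquot_r (lquot_r L [:: a]) u); last first.
  by apply: lang_ext => w; rewrite /lquot_r -cats1 catA.
apply: IH => {u}.
elim: SL => {L} [L GL|b|K L SK IK SL IL|L SL IL|K L SK IK SL IL].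
- by apply: SF_base; have [_ _ _ Dq _] := Gq; apply: (proj2 (Dq _ _ GL)).
- rewrite (_ : lquot_r _ _ = fun w => a = b /\ lword [::] w).
    by apply: SF_if; exact: SF_eps.
  apply: lang_ext => -[|c [|c' w]]; rewrite /lquot_r /lword /=.
  + by split=> [[->]|[->]].
  + by split=> [|[]].
  + by split=> [|[]].
- exact: SF_union IK IL.
- exact: SF_compl IL.
rewrite (_ : lquot_r _ _ =
   lunion (lconcat K (lquot_r L [:: a])) (fun w => L [::] /\ lquot_r K [:: a] w)).
  by apply: SF_union; [exact: SF_concat|exact: SF_if].
apply: lang_ext => w; split=> [[u [v [e [Ku Lv]]]]|].
- case/lastP: v e Lv => [|v b]; first by rewrite cats0 => e L0; right; rewrite /lquot_r e.
  rewrite -cats1 catA !cats1 => /rcons_inj[-> ->] Lv.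
  by left; exists u, v; rewrite /lquot_r cats1.
- case=> [[u [v [-> [Ku Lv]]]]|[L0 Kw]].
    by exists u, (v ++ [:: a]); rewrite catA.
  by exists (w ++ [:: a]), [::]; rewrite cats0.
Qed.

Lemma SF_quotient_algebra : quotient_algebra (SF G).
Proof.
split; [exact: SF_full|exact: SF_union|exact: SF_compl| |].
  by move=> u L SL; split; [exact: SF_quot_l|exact: SF_quot_r].
move=> L; elim=> {L} [L GL|b|K L SK [M [f hf]] SL [N [g hg]]|L SL [M [f hf]]|].
- by have [_ _ _ _] := Gq; apply.
(* [None] is the class of the empty word, [Some (Some a)] that of the letter [a], [Some None] that
   of all longer words. *)
- exists (option (option A)),
    (fun w => match w with [::] => None | [:: a] => Some (Some a) | _ => Some None end).
  move=> [|a [|a' u]] [|c [|c' v]] //= e x y; rewrite /lword; first by case: e => ->.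
  by move/(congr1 size); rewrite /= size_cat /= !addnS.
- exists (M * N)%type, (fun w => (f w, g w)) => u v [eu ev] x y.
  by case=> h; [left; apply: hf eu _ _ h|right; apply: hg ev _ _ h].
- exists M, f => u v e x y h h'; apply: h.
  exact: (hf v u).
- by move=> K L _ IK _ IL; exact: finite_index_concat.
Qed.

(** Aperiodicity relative to [G]: for [L] in [G], all powers of a word equivalent to the empty word
    are equivalent; the star-free operations only shrink [H] and raise [k]. *)
Lemma SF_aperiodic (L : lang A) : SF G L -> exists (H : lang A) (k : nat),
  [/\ G H, H [::] & forall w, H w -> forall m n x y, (k <= m)%N -> (k <= n)%N ->
     L (x ++ wpow m w ++ y) -> L (x ++ wpow n w ++ y)].
Proof.
have [GT GU GC _ _] := Gq.
have GI K K' : G K -> G K' -> G (linter K K') by exact: bool_inter.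
elim=> {L} [L GL|b|K L SK [H1 [k1 [G1 e1 h1]]] SL [H2 [k2 [G2 e2 h2]]]
  |L SL [H [k [GH e h]]]|K L SK [H1 [k1 [G1 e1 h1]]] SL [H2 [k2 [G2 e2 h2]]]].
- have [M [f [[fc fD] fL]]] := syntactic_map Gq GL.
  exists (fun w => f w = f [::]), 0%N; split=> //; first exact: (fD (fun x => x = f [::])).
  move=> w hw m n x y _ _.
  have E k : f (wpow k w) = f [::].
    by elim: k => // k IH; rewrite wpowS (fc _ [::] _ [::]).
  by have /fL/(_ x y) -> : f (wpow m w) = f (wpow n w) by rewrite !E.
(* Two copies of a nonempty word are already longer than the word [[:: b]]. *)
- exists (@lfull A), 2%N; split=> // w _ m n x y m2 n2; rewrite /lword.
  case: w => [|a w]; first by rewrite !wpow_nil.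
  by move/(congr1 size); rewrite !size_cat size_wpow /=; nia.
- exists (linter H1 H2), (maxn k1 k2); split; [exact: GI|by []|].
  move=> w [w1 w2] m n x y; rewrite !geq_max => /andP[a1 a2] /andP[b1 b2].
  by case=> h; [left; apply: h1 h|right; apply: h2 h].
- exists H, k; split=> // w hw m n x y km kn nL L'; apply: nL.
  exact: h L'.
(* One copy of [w] may be cut in two; of the others, at least [k1] lie to the left of the cut or at
   least [k2] to the right. *)
- exists (linter H1 H2), (k1 + k2).+1; split; [exact: GI|by []|].
  move=> w [w1 w2] m n x y hm hn [u [v [/esym e [Ku Lv]]]].
  case: (cat_eq_cat e) => -[z [ex ey]]; last first.
    exists u, (z ++ wpow n w ++ y); rewrite ex -catA; split=> //; split=> //.
    by apply: (h2 w w2 m); rewrite -?ey //; lia.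
  case: (cat_eq_cat (esym ey)) => -[t [ez et]]; last first.
    case: m hm e ey ez => // m hm e ey /wpow_eq_cat[i [j [v1 [v2 [em ew ez ez']]]]].
    (* A side below its threshold keeps its number of copies, and the other side absorbs the
       difference between [m] and [n]. *)
    have [i' [j' [en ei ej]]] : exists i' j', [/\ n = (i' + j').+1,
        i' = i \/ (k1 <= i)%N /\ (k1 <= i')%N & j' = j \/ (k2 <= j)%N /\ (k2 <= j')%N].
      case: (leqP k1 i) => hi.
        case: (leqP k2 j) => hj; last by exists (n - j.+1)%N, j; split; lia.
        by exists k1, (n - k1.+1)%N; split; lia.
      by exists i, (n - i.+1)%N; split; lia.
    exists (x ++ wpow i' w ++ v1), (v2 ++ wpow j' w ++ y); split; last split.
    + have -> : wpow n w = wpow i' w ++ v1 ++ v2 ++ wpow j' w.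
        by rewrite (catA v1) -ew -wpowS -wpowD; congr wpow; lia.
      by rewrite -!catA.
    + by move: Ku; rewrite ex ez; case: ei => [->//|[a b]]; apply: h1.
    + move: Lv; rewrite et ez' -catA; case: ej => [->//|[a b]] Lv.
      by apply: (h2 w w2 j).
  exists (x ++ wpow n w ++ t), v; rewrite et -!catA; split=> //; split=> //.
  by apply: (h1 w w1 m); rewrite -?ez -?ex //; lia.
Qed.

End StarFree.

(** * Soundness *)

Section Soundness.
Variables (A : finType) (R : finPzSemiRingType) (G : lang A -> Prop)
  (rho : lang A -> R) (om : nat).
Hypotheses (addI : idempotent_add R) (rhoR : rating_map rho)
  (rhoN : nice_rating rho) (rhoM : mult_rating rho).

Lemma opt_imprint_mono (D : lang A -> Prop) K L r :
  lsubset K L -> opt_imprint D K rho r -> opt_imprint D L rho r.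
Proof. by move=> sKL h Ks [DK cK]; apply: h; split=> // w /sKL/cK. Qed.

Lemma opt_imprint_word (D : lang A -> Prop) w :
  opt_imprint D (lword w) rho (rho (lword w)).
Proof.
move=> Ks [_ /(_ w erefl)[K [KKs Kw]]]; exists K; split=> //.
by apply: rating_mono => // _ ->.
Qed.

(** For [w] in [K], the quotients by [w] of the members of a cover of [K L] cover [L], so one of
    them, [w^-1 N], has value above [r]. Hence the languages [good N] cover [K], and one of them has
    value above [q]. *)
Lemma opt_imprint_concat (D : lang A -> Prop) K L q r : quotient_algebra D ->
  opt_imprint D K rho q -> opt_imprint D L rho r ->
  opt_imprint D (lconcat K L) rho (q * r).
Proof.
move=> DQ hq hr Ks [DKs cKs].
have [M [f [[fc fD] fK]]] := syntactic_map_seq DQ DKs.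
pose good N : lang A := fun w => rle r (rho (lquot_l w N)).
have [_ [/List.in_map_iff[N [<- inN]] leN]] : imprint rho (List.map good Ks) q.
  apply: hq; split.
    move=> _ /List.in_map_iff[N [<- inN]].
    (* [w^-1 N] depends only on [f w], so [good N] is a union of classes. *)
    rewrite (_ : good N = fun w => exists w', f w' = f w /\ good N w').
      exact: (fD (fun m => exists w', f w' = m /\ good N w')).
    apply: lang_ext => w; split=> [gw|[w' [e]]]; first by exists w.
    rewrite /good; suff -> : lquot_l w' N = lquot_l w N by [].
    apply: lang_ext => z; rewrite /lquot_l.
    by split; apply: fK; rewrite // (fc _ w _ z) // (fc w' w z z).
  move=> w Kw.
  have [_ [/List.in_map_iff[N [<- inN]] leN]] : imprint rho (List.map (lquot_l w) Ks) r.
    apply: hr; split.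
      move=> _ /List.in_map_iff[N [<- inN]]; have [_ _ _ Dq _] := DQ.
      exact: (proj1 (Dq _ _ (DKs _ inN))).
    move=> v Lv; have [|N [inN Nwv]] := cKs (w ++ v); first by exists w, v.
    by exists (lquot_l w N); split=> //; apply/List.in_map_iff; exists N.
  by exists (good N); split=> //; apply/List.in_map_iff; exists N.
exists N; split=> //.
apply: rle_trans (rleM leN (rle_refl addI r)) _.
(* Niceness reduces [good N] to finitely many words [w], and for each of them [rho w * r <= rho w *
   rho (w^-1 N) <= rho N]. *)
have [F [sF ->]] := rating_nice_sum rhoR (good N) rhoN.
rewrite mulr_suml; apply: rle_sum => w /sF gw _.
apply: rle_trans (rleM (rle_refl addI _) gw) _; apply: rating_prod_le => //.
by move=> _ [_ [v [-> [-> Nv]]]].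
Qed.

Hypotheses (om_gt0 : (0 < om)%N)
  (omI : forall r : R, r ^+ om * r ^+ om = r ^+ om) (Gq : quotient_algebra G).

Let tau K := opt_imprint (SF G) K rho.
Let S0 := iota_opt G tau.

Let SFq : quotient_algebra (SF G).
Proof. by have [GT _ _ _ _] := Gq; exact: SF_quotient_algebra. Qed.

Lemma SF_imprint_complete_mul q r : S0 q -> S0 r -> S0 (q * r).
Proof.
move=> hq hr L GL L0; have [H [GH H0 HM HL]] := syntactic_kernel Gq GL L0.
apply: (@opt_imprint_mono _ (lconcat H H)).
  move=> _ [u [v [-> [Hu Hv]]]].
  by have /= := HL [::] _ v Hu => ->; have := HL [::] v [::] Hv; rewrite /= cats0 => ->.
by apply: opt_imprint_concat; [exact: SFq|exact: hq|exact: hr].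
Qed.

Lemma SF_imprint_complete_iota r : iota_opt G (mu rho S0) r -> S0 r.
Proof.
move=> hr L GL L0; have [H [GH H0 HM HL]] := syntactic_kernel Gq GL L0.
have [w [Lw mw]] := hr L GL L0.
(* [W] is [w] with each letter surrounded by [H]; the left context [x] is quantified for the
   induction on [w]. *)
suff [W tW LW] : exists2 W, tau W r & forall z, W z -> forall x, L (x ++ z) <-> L (x ++ w).
  by apply: opt_imprint_mono tW => z /LW/(_ [::])/= ->.
elim: w r mw {hr Lw} => [|a w IH] r /=.
  move=> ->; exists (lword [::]); last by move=> z ->.
  by rewrite -(proj1 rhoM); exact: opt_imprint_word.
move=> [_ [y [[s [s' [Ss [Ss' ->]]]] [/IH[W tW LW] ->]]]].
exists (lconcat (lconcat (lconcat H (lword [:: a])) H) W).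
  apply: opt_imprint_concat => //.
  apply: opt_imprint_concat; [by []| |exact: Ss'].
  by apply: opt_imprint_concat; [by []|exact: Ss|exact: opt_imprint_word].
move=> _ [_ [z [-> [[_ [v [-> [[u [_ [-> [Hu ->]]]] Hv]]]] Wz]]]] x.
by rewrite -!catA HL // catA HL // LW // -catA.
Qed.

Lemma SF_imprint_complete_omega r : S0 r -> S0 (r ^+ om + r ^+ om.+1).
Proof.
move=> hr L GL L0 Ks [SKs cKs].
have [GT GU GC _ _] := Gq.
have [H [GH H0 HM HL]] := syntactic_kernel Gq GL L0.
have [H' [k [GH' H'0 hk]]] : exists (H' : lang A) (k : nat), [/\ G H', H' [::] &
    forall w, H' w -> forall K, List.In K Ks -> forall m n, (k <= m)%N -> (k <= n)%N ->
    K (wpow m w) -> K (wpow n w)].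
  elim: Ks SKs {cKs} => [|K Ks IH] SKs; first by exists (@lfull A), 0%N; split.
  have [|H1 [k1 [G1 e1 h1]]] := IH; first by move=> K' iK; apply: SKs; right.
  have [H2 [k2 [G2 e2 h2]]] := SF_aperiodic Gq (SKs K (or_introl erefl)).
  exists (linter H1 H2), (maxn k1 k2); split; [exact: bool_inter|by []|].
  move=> w [w1 w2] K' iK m n; rewrite !geq_max => /andP[a1 a2] /andP[b1 b2].
  case: iK => [<-|iK]; last exact: (h1 w).
  by have := h2 w w2 m n [::] [::] a2 b2; rewrite /= !cats0.
have [M [f [[fc fD] fK]]] := syntactic_map_seq SFq SKs.
pose cls m : lang A := fun w => f w = m.
(* The intersection of [H] and [H'] is covered by the classes that meet it, so the class found above
   [r] has a representative [w] in both identities. *)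
have [w [[Hw H'w] lw]] : exists w, linter H H' w /\ rle r (rho (cls (f w))).
  pose ms := [seq m <- enum M | `[< exists2 w, linter H H' w & f w = m >]].
  have cov : is_cover (SF G) (linter H H') (List.map cls ms).
    split=> [_ /List.in_map_iff[m [<- _]]|w hw].
      exact: (fD (fun x => x = m)).
    exists (cls (f w)); split=> //; apply/List.in_map_iff; exists (f w); split=> //.
    have : f w \in ms by rewrite mem_filter mem_enum andbT; apply/asboolP; exists w.
    elim: ms => // m ms IH; rewrite inE => /orP[/eqP->|/IH]; [by left|by right].
  have [_ [/List.in_map_iff[m [<- inm]] lem]] :=
    hr (linter H H') (bool_inter GU GC GH GH') (conj H0 H'0) _ cov.
  have : m \in ms.
    elim: ms inm {cov} => // m' ms IH [->|/IH]; rewrite inE ?eqxx // => ->.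
    by rewrite orbT.
  rewrite mem_filter => /andP[/asboolP[w hw e] _]; exists w; split=> //.
  by rewrite e.
(* A multiple of [om] that is at least [k]: [r ^+ n] equals [r ^+ om], and the [n]-th power of [w]
   is past the threshold. *)
pose n := (om * k.+1)%N.
have kn : (k <= n)%N by rewrite /n; nia.
have Hn j : H (wpow j w) by elim: j => // j IH; rewrite wpowS; exact: HM.
have [|K [inK Kw]] := cKs (wpow n w).
  by have := HL [::] _ [::] (Hn n); rewrite /= cats0 => ->.
exists K; split=> //.
have le_cls j : rle (r ^+ j) (rho (cls (f (wpow j w)))).
  elim: j => [|j IH].
    rewrite expr0 -(proj1 rhoM); apply: rating_mono => // _ -> //.
  rewrite exprS; apply: rle_trans (rleM lw IH) _; apply: rating_prod_le => //.
  move=> _ [u [v [-> [hu hv]]]]; rewrite /cls wpowS; exact: fc.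
have sub j : (k <= j)%N -> lsubset (cls (f (wpow j w))) K.
  move=> kj u fu; apply: (fK K inK (wpow j w)); first by rewrite fu.
  exact: (hk w H'w K inK n).
(* The summands become [r ^+ n] and [r ^+ n.+1], bounded by the classes of two successive powers of
   [w], both inside [K]. *)
rewrite exprS -(idem_exp_mul k (omI r)) -exprS.
by apply: rle_add; (apply: rle_trans (le_cls _) _; apply: rating_mono => //; apply: sub;
  rewrite // ltnW).
Qed.

Lemma SF_imprint_complete : SF_complete G rho om S0.
Proof.
split.
- move=> q r hr qr L GL L0 Ks cK; have [K [iK rK]] := hr L GL L0 Ks cK.
  by exists K; split=> //; exact: rle_trans rK.
- exact: SF_imprint_complete_mul.
- exact: SF_imprint_complete_iota.
- exact: SF_imprint_complete_omega.
Qed.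

End Soundness.

(** * Covers by induction on a graded set of values *)

Section GradedCover.
Variables (R : finPzSemiRingType) (H : finGroupType).
Hypothesis addI : idempotent_add R.

Let M := (R * H)%type.

Definition gmul (p q : M) : M := (p.1 * q.1, (p.2 * q.2)%g).
Definition gone : M := (1, 1%g).
Definition gle (p q : M) : Prop := rle p.1 q.1 /\ p.2 = q.2.

Lemma gmulA p q r : gmul p (gmul q r) = gmul (gmul p q) r.
Proof. by rewrite /gmul /= mulrA mulgA. Qed.

Lemma gmul1 p : gmul p gone = p.
Proof. by rewrite /gmul /= mulr1 mulg1; case: p. Qed.

Lemma gone_mul p : gmul gone p = p.
Proof. by rewrite /gmul /= mul1r mul1g; case: p. Qed.

Lemma gle_refl p : gle p p.
Proof. by split=> //; exact: rle_refl. Qed.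

Lemma gleM p q p' q' : gle p p' -> gle q q' -> gle (gmul p q) (gmul p' q').
Proof. by move=> [h1 e1] [h2 e2]; split; [exact: rleM|rewrite /= e1 e2]. Qed.

Section Values.
Variables (B : Type) (v : B -> M).

Definition wval (w : seq B) : M := foldr (fun b p => gmul (v b) p) gone w.

Lemma wval_cat w w' : wval (w ++ w') = gmul (wval w) (wval w').
Proof. by elim: w => [|b w IH] /=; rewrite ?gone_mul // IH gmulA. Qed.

Lemma wval1 b : wval [:: b] = v b.
Proof. exact: gmul1. Qed.
End Values.

Lemma wval_wpow (B : eqType) (v : B -> M) n w :
  wval v (wpow n w) = ((wval v w).1 ^+ n, ((wval v w).2 ^+ n)%g).
Proof.
by elim: n => [|n IH] //; rewrite wpowS wval_cat IH /gmul /= exprS expgS.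
Qed.

(** Stand-in for [G] over the changing alphabets [B]: the languages determined by the degree in
    [H]. *)
Definition graded (B : finType) (v : B -> M) (L : lang B) : Prop :=
  exists P : H -> Prop, L = fun w => P (wval v w).2.

Lemma graded_full (B : finType) (v : B -> M) : graded v (@lfull B).
Proof. by exists (fun _ => True). Qed.

Variables (T : M -> Prop) (om : nat).
Hypotheses (om_gt0 : (0 < om)%N) (omI : forall r : R, r ^+ om * r ^+ om = r ^+ om).
Hypotheses (T1 : T gone) (TM : forall p q, T p -> T q -> T (gmul p q))
  (Tom : forall r, T (r, 1%g) -> T (r ^+ om + r ^+ om.+1, 1%g)).

(** The left orbit [T d]. Right multiplications commute with the left action of [T], so one of them
    preserves the orbit as soon as it sends [d] into it. *)
Definition orb (d x : M) : Prop := exists2 t, T t & x = gmul t d.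

Lemma orb_refl d : orb d d.
Proof. by exists gone; rewrite ?gone_mul. Qed.

Lemma orb_mull d x t : T t -> orb d x -> orb d (gmul t x).
Proof. by move=> Tt [s Ts ->]; exists (gmul t s); [exact: TM|rewrite gmulA]. Qed.

Lemma orb_mulr d x p : orb d x -> orb d (gmul d p) -> orb d (gmul x p).
Proof. by move=> [t Tt ->] h; rewrite -gmulA; exact: orb_mull. Qed.

(** [kap] names the piece of a word and [u i] bounds the values in piece [i]. The last condition
    also concerns empty pieces; for [d = gone] it says that [u i] lies in [T]. *)
Definition graded_cover (B : finType) (C : {set B}) (v : B -> M) (d : M) : Prop :=
  exists (I : finType) (kap : seq B -> I) (u : I -> M),
  [/\ forall i, SF (graded v) (fun w => all (mem C) w /\ kap w = i),
      forall w, all (mem C) w -> gle (wval v w) (u (kap w)) &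
      forall i, orb d (gmul d (u i))].

(** * Letters acting injectively on the orbit *)

Section Permutation.
Variables (B : finType) (C : {set B}) (v : B -> M) (d : M).
Hypotheses (stab : forall b, b \in C -> orb d (gmul d (v b)))
  (inj : forall b x y, b \in C -> orb d x -> orb d y ->
     gmul x (v b) = gmul y (v b) -> x = y).

Lemma orb_wval w x : all (mem C) w -> orb d x -> orb d (gmul x (wval v w)).
Proof.
elim: w x => [|b w IH] x /=; first by rewrite gmul1.
by move=> /andP[bC wC] hx; rewrite gmulA; apply: IH => //; apply: orb_mulr (stab bC).
Qed.

Lemma orb_wval_inj w x y : all (mem C) w -> orb d x -> orb d y ->
  gmul x (wval v w) = gmul y (wval v w) -> x = y.
Proof.
elim: w x y => [|b w IH] x y /=; first by rewrite !gmul1.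
move=> /andP[bC wC] hx hy; rewrite !gmulA => /IH e.
by apply: (inj bC) => //; apply: e => //; apply: orb_mulr (stab bC).
Qed.

(** An idempotent that acts injectively acts as the identity. *)
Lemma orb_wval_id w x : all (mem C) w -> gmul (wval v w) (wval v w) = wval v w ->
  orb d x -> gmul x (wval v w) = x.
Proof.
move=> wC e hx; apply: (orb_wval_inj wC) => //; first exact: orb_wval.
by rewrite -gmulA e.
Qed.

Lemma all_wpow n w : all (mem C) w -> all (mem C) (wpow n w).
Proof. by move=> wC; elim: n => // n IH; rewrite wpowS all_cat wC. Qed.

Definition gval (g : H) (r : R) : Prop := exists2 w, all (mem C) w & wval v w = (r, g).

Definition gsum (g : H) : R := \sum_(r <- enum R | `[< gval g r >]) r.

Lemma gsum_ub g r : gval g r -> rle r (gsum g).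
Proof. by move=> h; apply: rle_sumr; rewrite ?mem_enum //; apply/asboolP. Qed.

Lemma gsum_lub g q : (forall r, gval g r -> rle r q) -> rle (gsum g) q.
Proof. by move=> h; apply: rle_sum => r _ /asboolP/h. Qed.

Lemma gval1 : gval 1%g 1.
Proof. by exists [::]. Qed.

Lemma gvalM g h r s : gval g r -> gval h s -> gval (g * h)%g (r * s).
Proof.
move=> [w wC ew] [w' wC' ew']; exists (w ++ w'); first by rewrite all_cat wC.
by rewrite wval_cat ew ew'.
Qed.

(* Multiplying by [r ^+ om + r ^+ om.+1] replaces [q] by [q + q * r], because [r ^+ om]
   acts trivially; iterating collects all words of degree 1. *)
Lemma orb_partial_sum (rs : seq R) : (forall r, r \in rs -> gval 1%g r) ->
  exists Q : seq R, [/\ 1 \in Q, {subset rs <= Q}, forall q, q \in Q -> gval 1%g q &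
    exists2 t, T (t, 1%g) & d.1 * (\sum_(q <- Q) q) = t * d.1].
Proof.
elim: rs => [|r rs IH] h.
  exists [:: 1]; split; rewrite ?mem_head //; first by move=> q; rewrite inE => /eqP->; exact: gval1.
  by exists 1; rewrite // big_seq1 mulr1 mul1r.
have [|Q [Q1 sQ hQ [t Tt et]]] := IH.
  by move=> q qs; apply: h; rewrite inE qs orbT.
have hr : gval 1%g r by apply: h; rewrite mem_head.
have [w wC ew] := hr.
(* Multiplying [d] by [r] on the right is multiplying it by [tr] on the left, and [tr] has degree 1
   by cancellation in [H]. [Tom] is applied to [tr], since [r] itself is not known to lie in [T]. *)
have [[tr g] Tr] := orb_wval wC (orb_refl d).
rewrite ew /gmul /= mulg1 => -[er /esym/(canRL (mulgK _))]; rewrite mulgV => g1.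
have er' n : d.1 * r ^+ n = tr ^+ n * d.1.
  elim: n => [|n IHn]; first by rewrite !expr0 mulr1 mul1r.
  by rewrite !exprS mulrA er -mulrA IHn mulrA.
exists (Q ++ [seq q * r | q <- Q]); split.
- by rewrite mem_cat Q1.
- move=> q; rewrite inE mem_cat => /orP[/eqP->|/sQ->//].
  by apply/orP; right; apply/mapP; exists 1; rewrite ?mul1r.
- move=> q; rewrite mem_cat => /orP[/hQ//|/mapP[q' /hQ hq' ->]].
  by rewrite -[1%g](mulg1 (1%g : H)); exact: gvalM.
exists (t * (tr ^+ om + tr ^+ om.+1)).
  have := TM Tt (Tom _); rewrite /gmul /= mulg1; apply.
  by rewrite g1 in Tr.
rewrite -mulrA mulrDl -!er' -mulrDr mulrA -et.
rewrite big_cat big_map /= -big_split /= mulr_sumr mulr_sumr mulr_suml.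
rewrite big_seq [RHS]big_seq; apply: eq_bigr => q /hQ [wq wqC ewq].
suff e : d.1 * q * r ^+ om = d.1 * q by rewrite exprSr !mulrDr !mulrA e.
have x_orb := orb_wval wqC (orb_refl d).
have := @orb_wval_id (wpow om w) _ (all_wpow om wC) _ x_orb.
rewrite wval_wpow ew ewq /gmul /= expg1n !mulg1 omI => /(_ erefl) [].
by [].
Qed.

Lemma orb_gsum1 : orb d (gmul d (gsum 1%g, 1%g)).
Proof.
have [|Q [Q1 sQ hQ [t Tt et]]] := @orb_partial_sum [seq r <- enum R | `[< gval 1%g r >]].
  by move=> r; rewrite mem_filter => /andP[/asboolP].
exists (t, 1%g) => //; rewrite /gmul /= mulg1 mul1g; congr (_, _).
rewrite -et; congr (_ * _); apply: rle_anti.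
  apply: gsum_lub => r hr; apply: (rle_sumr addI (fun q : R => q)) => //.
  by apply: sQ; rewrite mem_filter mem_enum andbT; apply/asboolP.
by apply: rle_sum => q /hQ hq _; exact: gsum_ub.
Qed.

(** Reduction to degree 1: [d * gsum g = d * gsum 1 * s] with [s] the value of [w0]. A suitable
    power [w0^n] fixes the orbit, so a word [w] of degree [g] acts on [d] like [w w0^(n-1)], of
    degree 1, followed by [w0]. *)
Lemma orb_gsum g w0 : all (mem C) w0 -> (wval v w0).2 = g ->
  orb d (gmul d (gsum g, g)).
Proof.
move=> w0C eg; set s := (wval v w0).1.
have e0 : wval v w0 = (s, g) by rewrite -eg /s; case: (wval v w0).
suff -> : gmul d (gsum g, g) = gmul (gmul d (gsum 1%g, 1%g)) (s, g).
  by rewrite -e0; apply: orb_wval => //; exact: orb_gsum1.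
rewrite /gmul /= mulg1; congr (_, _); apply: rle_anti; last first.
  rewrite -mulrA; apply: rleM; first exact: rle_refl.
  rewrite mulr_suml; apply: rle_sum => r _ /asboolP hr; apply: gsum_ub.
  by rewrite -[g]mul1g; apply: gvalM => //; exists w0.
rewrite mulr_sumr; apply: rle_sum => r _ /asboolP [w wC ew].
(* The factor [om] makes the value idempotent, the factor [#|H|] makes the degree trivial. *)
pose n := (om * #|H|)%N.
have n_gt0 : (0 < n)%N by rewrite muln_gt0 om_gt0; apply/card_gt0P; exists 1%g.
have gn1 : (g ^+ n = 1)%g.
  by rewrite /n mulnC expgM -cardsT expg_cardG ?inE // expg1n.
have idem : gmul (wval v (wpow n w0)) (wval v (wpow n w0)) = wval v (wpow n w0).
  rewrite wval_wpow e0 /gmul /= gn1 mulg1; congr (_, _).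
  by rewrite /n -(prednK (_ : 0 < #|H|)%N) ?idem_exp_mul //; apply/card_gt0P; exists 1%g.
have := orb_wval_id (all_wpow n w0C) idem (orb_wval wC (orb_refl d)).
rewrite -(prednK n_gt0) wval_wpow e0 ew /gmul /= => -[<- _].
rewrite exprSr !mulrA; apply: rleM; last exact: rle_refl.
rewrite -mulrA; apply: rleM; first exact: rle_refl.
apply: gsum_ub; exists (w ++ wpow n.-1 w0); first by rewrite all_cat wC all_wpow.
by rewrite wval_cat wval_wpow ew e0 /gmul /= -expgS prednK // gn1.
Qed.

Lemma graded_cover_permutation : graded_cover C v d.
Proof.
pose hit g := `[< exists2 w, all (mem C) w & (wval v w).2 = g >].
(* A degree reached by no word gets the default [gone], which satisfies the orbit condition. *)
exists H, (fun w => (wval v w).2), (fun g => if hit g then (gsum g, g) else gone).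
split=> [g|w wC|g].
- apply: (@SF_inter _ _ (fun w => all (mem C) w) (fun w => (wval v w).2 = g)).
    by apply: SF_letters; exact: graded_full.
  by apply: SF_base; exists (fun h => h = g).
- rewrite (_ : hit _ = true); last by apply/asboolP; exists w.
  by split=> //; apply: gsum_ub; exists w => //; case: (wval v w).
- case: ifP => [/asboolP[w wC]|_]; first exact: orb_gsum.
  by rewrite gmul1; exact: orb_refl.
Qed.

End Permutation.

(** * Cutting words at the occurrences of a letter *)

Section Split.
Variables (B : finType) (C : {set B}) (v : B -> M) (d : M) (c : B).
Variables (I : finType) (kap : seq B -> I) (u : I -> M).
Hypothesis cC : c \in C.
Hypothesis stab : orb d (gmul d (v c)).
Let cfree : pred (seq B) := all (mem (C :\ c)).
Let fiber i : lang B := fun w => cfree w /\ kap w = i.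
Hypotheses (fiberSF : forall i, SF (graded v) (fiber i))
  (uP : forall w, cfree w -> gle (wval v w) (u (kap w)))
  (uO : forall i, orb d (gmul d (u i))).

Definition blocks (bs : seq (seq B)) := flatten [seq rcons w c | w <- bs].

(** Each block is the stretch before an occurrence of [c], with that [c] dropped; the second
    component is what follows the last [c]. *)
Fixpoint parse (w : seq B) : seq (seq B) * seq B :=
  if w is b :: w' then
    let: (bs, r) := parse w' in
    if b == c then ([::] :: bs, r)
    else if bs is x :: bs' then ((b :: x) :: bs', r) else ([::], b :: r)
  else ([::], [::]).

Lemma parseK w : blocks (parse w).1 ++ (parse w).2 = w.
Proof.
elim: w => //= b w; case: (parse w) => bs r /= IH.
case: eqP => [->|_]; first by rewrite /= -IH.
by case: bs IH => [|x bs] /= <-.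
Qed.

Lemma parse_free w : all (mem C) w -> all cfree (parse w).1 /\ cfree (parse w).2.
Proof.
elim: w => //= b w IH /andP[bC /IH]; case: (parse w) => bs r /= [h1 h2] {IH}.
case: eqP => [_|/eqP nb] //=.
by case: bs h1 => [|x bs] /= h1; rewrite !inE nb bC.
Qed.

Lemma blocksK bs r : all cfree bs -> cfree r -> parse (blocks bs ++ r) = (bs, r).
Proof.
have step b x : cfree (b :: x) -> (b == c) = false.
  by rewrite /cfree /= !inE => /andP[/andP[/negbTE]].
elim: bs => [_|x bs IH /= /andP[xf bsf]] rf.
  rewrite /=; elim: r rf => //= b r IHr brf.
  by rewrite (step _ _ brf) IHr //; case/andP: brf.
have := IH bsf rf; rewrite /blocks /= cat_rcons -catA => e.
elim: x xf => [|b x IHx] bxf /=; first by rewrite e eqxx.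
by rewrite IHx ?(step _ _ bxf) //; case/andP: bxf.
Qed.

Lemma blocks_inj bs bs' : all cfree bs -> all cfree bs' ->
  blocks bs = blocks bs' -> bs = bs'.
Proof.
move=> h h' e; have := @blocksK bs [::] h isT.
by rewrite e (@blocksK bs' [::] h' isT) => -[].
Qed.

Lemma blocks_cat bs bs' : blocks (bs ++ bs') = blocks bs ++ blocks bs'.
Proof. by rewrite /blocks map_cat flatten_cat. Qed.

Lemma cfreeW w : cfree w -> all (mem C) w.
Proof. by apply: sub_all => b; rewrite /= !inE => /andP[]. Qed.

Lemma blocksC bs : all cfree bs -> all (mem C) (blocks bs).
Proof.
elim: bs => //= x bs IH /andP[/cfreeW xf /IH bsf].
by rewrite /blocks /= all_cat all_rcons /= cC xf.
Qed.

(** Inverse image of [F] under the recoding that reads each block [x c] as the letter [kap x]. *)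
Definition expand (F : lang I) : lang B := fun w =>
  exists bs, [/\ all cfree bs, w = blocks bs & F (map kap bs)].

Let v' i := gmul (u i) (v c).

Lemma wval_blocks bs : all cfree bs ->
  gle (wval v (blocks bs)) (wval v' (map kap bs)).
Proof.
elim: bs => [_|x bs IH /= /andP[xf bsf]]; first exact: gle_refl.
rewrite /blocks /= wval_cat -cats1 wval_cat wval1; apply: gleM (IH bsf).
by apply: gleM; [exact: uP|exact: gle_refl].
Qed.

Lemma expand_full : SF (graded v) (expand (@lfull I)).
Proof.
have fullG := graded_full v.
rewrite (_ : expand _ = lunion (lword [::])
  (lconcat (fun w => all (mem C) w) (lword [:: c]))).
  apply: SF_union; first exact: SF_eps.
  by apply: SF_concat; [exact: SF_letters|exact: SF_letter].
apply: lang_ext => w; split.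
  move=> [bs [bf -> _]]; case/lastP: bs bf => [|bs x]; first by left.
  rewrite all_rcons => /andP[xf bsf]; right; exists (blocks bs ++ x), [:: c].
  rewrite -cats1 blocks_cat /blocks /= cats0 -cats1 catA all_cat blocksC //.
  by rewrite (cfreeW xf).
case=> [->|[x [_ [-> [xC ->]]]]]; first by exists [::].
have [h1 h2] := parse_free xC; exists (rcons (parse x).1 (parse x).2).
rewrite all_rcons h1 h2 -cats1 blocks_cat; split=> //.
by rewrite -{1}(parseK x) -catA /blocks /= cats0 cats1.
Qed.

(** The recoding preserves degrees, so graded conditions pull back to graded conditions. Complements
    are taken within the recodable words and rely on unique parsing; concatenations are cut between
    blocks. *)
Lemma expand_SF F : SF (graded v') F -> SF (graded v) (expand F).
Proof.
have fullG := graded_full v.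
elim=> {F} [F [P ->]|i|F F' SF1 IH1 SF2 IH2|F SF1 IH1|F F' SF1 IH1 SF2 IH2].
- rewrite (_ : expand _ = linter (expand (@lfull I)) (fun w => P (wval v w).2)).
    by apply: SF_inter; [exact: expand_full|apply: SF_base; exists P].
  apply: lang_ext => w; split=> [[bs [bf -> Pb]]|[[bs [bf -> _]] Pb]].
    by split; [exists bs|rewrite (proj2 (wval_blocks bf))].
  by exists bs; rewrite -(proj2 (wval_blocks bf)).
- rewrite (_ : expand _ = lconcat (fiber i) (lword [:: c])).
    by apply: SF_concat; [exact: fiberSF|exact: SF_letter].
  apply: lang_ext => w; split.
    move=> [[|x [|y bs]] [//= /andP[xf _] -> [ki]]].
    by exists x, [:: c]; rewrite /blocks /= cats0 cats1.
  move=> [x [_ [-> [[xf ki] ->]]]]; exists [:: x]; rewrite /= xf ki; split=> //.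
  by rewrite /blocks /= cats0 cats1.
- rewrite (_ : expand _ = lunion (expand F) (expand F')); first exact: SF_union.
  apply: lang_ext => w; split; last by case=> -[bs [bf -> h]]; exists bs; split=> //; [left|right].
  by move=> [bs [bf -> [h|h]]]; [left|right]; exists bs.
- rewrite (_ : expand _ = linter (expand (@lfull I)) (lcompl (expand F))).
    by apply: SF_inter; [exact: expand_full|exact: SF_compl].
  apply: lang_ext => w; split=> [[bs [bf -> nF]]|[[bs [bf -> _]] nF]].
    split; first by exists bs.
    by move=> [bs' [bf' /(blocks_inj bf bf') <- ]].
  by exists bs; split=> // Fb; apply: nF; exists bs.
- rewrite (_ : expand _ = lconcat (expand F) (expand F')); first exact: SF_concat.
  apply: lang_ext => w; split.
    move=> [bs [bf -> [s [s' [e [Fs Fs']]]]]].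
    have es : s = map kap (take (size s) bs) by rewrite map_take e take_size_cat.
    have es' : s' = map kap (drop (size s) bs) by rewrite map_drop e drop_size_cat.
    move: bf; rewrite -{1}(cat_take_drop (size s) bs) all_cat => /andP[b1 b2].
    exists (blocks (take (size s) bs)), (blocks (drop (size s) bs)).
    rewrite -blocks_cat cat_take_drop; split=> //; split.
      by exists (take (size s) bs); rewrite -es.
    by exists (drop (size s) bs); rewrite -es'.
  move=> [_ [_ [-> [[bs [bf -> Fb]] [bs' [bf' -> Fb']]]]]].
  exists (bs ++ bs'); rewrite all_cat bf bf' blocks_cat map_cat; split=> //.
  by exists (map kap bs), (map kap bs').
Qed.

(* A word [x0 c x1 c ... c xk] is cut as [x0 . c . (x1 c ... c) . xk]. *)
Lemma graded_cover_split : graded_cover [set: I] v' (gmul d (v c)) ->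
  graded_cover C v d.
Proof.
move=> [I' [kap' [u' [fib' uP' uO']]]].
(* Words without [c] keep their piece; the others are sorted by the pieces of [x0], of the recoded
   middle part and of [xk]. *)
exists (I + I * I' * I)%type, (fun w => match parse w with
  | ([::], r) => inl (kap r)
  | (x :: bs, r) => inr (kap x, kap' (map kap bs), kap r) end),
 (fun z => match z with inl i => u i
  | inr (i, f, j) => gmul (gmul (gmul (u i) (v c)) (u' f)) (u j) end).
split.
- have fib2 f : SF (graded v) (expand (fun s => kap' s = f)).
    apply: expand_SF; rewrite (_ : (fun s => _) = fun s => all (mem [set: I]) s /\ kap' s = f).
      exact: fib'.
    apply: lang_ext => s; split=> [->|[]//]; split=> //.
    by apply/allP => x _; rewrite inE.
  move=> [i|[[i f] j]].
    rewrite (_ : (fun w => _) = fiber i) //.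
    apply: lang_ext => w; split=> [[wC]|[wf kw]].
      have := parseK w; have [_] := parse_free wC.
      by case: (parse w) => -[|x bs] r //= rf <- [].
    split; first exact: cfreeW.
    by have := @blocksK [::] w isT wf; rewrite /= => ->; rewrite kw.
  rewrite (_ : (fun w => _) = lconcat (lconcat (lconcat (fiber i) (lword [:: c]))
     (expand (fun s => kap' s = f))) (fiber j)).
    by do !apply: SF_concat => //; exact: SF_letter.
  apply: lang_ext => w; split=> [[wC]|].
    have := parseK w; have [] := parse_free wC.
    case: (parse w) => -[|x bs] r //= /andP[xf bsf] rf <- [e1 e2 e3].
    exists (blocks (x :: bs)), r; split=> //; split=> //.
    exists (rcons x c), (blocks bs); split=> //; split; last by exists bs.
    by exists x, [:: c]; rewrite cats1.
  move=> [_ [r [-> [[_ [_ [-> [[x [_ [-> [[xf xi] ->]]]] [bs [bsf -> ef]]]]]] [rf rj]]]]].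
  have e : ((x ++ [:: c]) ++ blocks bs) ++ r = blocks (x :: bs) ++ r.
    by rewrite cats1.
  have bf : all cfree (x :: bs) by rewrite /= xf.
  rewrite e (blocksK bf rf) xi ef rj all_cat (blocksC bf) (cfreeW rf).
  by split.
- move=> w wC; have := parseK w; have [] := parse_free wC.
  case: (parse w) => -[|x bs] r /=; first by move=> _ rf <-; exact: uP.
  move=> /andP[xf bsf] rf <-; rewrite wval_cat /blocks /= wval_cat -cats1 wval_cat wval1.
  apply: gleM (uP rf); apply: gleM.
    by apply: gleM; [exact: uP|exact: gle_refl].
  have [h1 e1] := wval_blocks bsf.
  have [|h2 e2] := uP' (map kap bs); first by apply/allP => y _; rewrite inE.
  by split; [exact: rle_trans h2|rewrite e1].
- move=> [i|[[i f] j]]; first exact: uO.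
  (* [d (u i)] is [t d]; multiplying [d] by [c] and then by [u' f] stays in [T (d c)], which is
     contained in [T d]. *)
  have [t Tt e] := uO i; rewrite !gmulA e.
  apply: orb_mulr; last exact: uO.
  rewrite -!gmulA; apply: orb_mull => //; rewrite gmulA.
  by have [t' Tt' ->] := uO' f; exact: orb_mull.
Qed.

End Split.

(* Lexicographic induction on the sizes of [T d] and of [C]. *)
Lemma graded_cover_exists (B : finType) (C : {set B}) (v : B -> M) (d : M) :
  (forall b, b \in C -> orb d (gmul d (v b))) -> graded_cover C v d.
Proof.
pose X d := [set x | `[< orb d x >]].
(* The alphabet is generalized because the smaller orbit is treated over the alphabet [I]. *)
have [n] := ubnP #|X d|; elim: n B C v d => // n IHn B C v d Xn.
have [m] := ubnP #|C|; elim: m C => // m IHm C Cm stab.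
have [[c [cC nc]]|inj] := pselect (exists c, c \in C /\
    exists x y, [/\ orb d x, orb d y, gmul x (v c) = gmul y (v c) & x <> y]); last first.
  apply: graded_cover_permutation => // b x y bC hx hy e.
  by apply: contrapT => ne; apply: inj; exists b; split=> //; exists x, y.
have [||I [kap [u [fib uP uO]]]] := IHm (C :\ c).
- by move: Cm; rewrite (cardsD1 c) cC.
- by move=> b; rewrite inE => /andP[_ /stab].
apply: (graded_cover_split cC (stab c cC) fib uP uO); apply: IHn; last first.
  move=> i _; have [t Tt e] := orb_mulr (stab c cC) (uO i).
  by rewrite gmulA e -gmulA; exact: orb_mull (orb_refl _).
suff : (#|X (gmul d (v c))| < #|X d|)%N by move=> h; exact: leq_trans h Xn.
(* [T (d c)] is the image of [T d] under right multiplication by [c], which is not injective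
   there. *)
have -> : X (gmul d (v c)) = [set gmul x (v c) | x in X d].
  apply/setP=> y; rewrite inE; apply/asboolP/imsetP => [[t Tt ->]|[x]].
    by exists (gmul t d); rewrite ?gmulA // inE; apply/asboolP; exists t.
  by rewrite inE => /asboolP[t Tt ->] ->; exists t; rewrite ?gmulA.
rewrite ltn_neqAle leq_imset_card andbT; apply/negP => /imset_injP inj.
have [x [y [hx hy e ne]]] := nc; apply: ne; apply: inj; rewrite ?inE //; exact/asboolP.
Qed.

End GradedCover.

(** * Completeness *)

Section GroupLanguages.
Variable A : finType.

Definition gprod (gT : finGroupType) (h : A -> gT) (w : seq A) : gT :=
  foldr (fun a g => (h a * g)%g) 1%g w.

Lemma gprod_cat (gT : finGroupType) (h : A -> gT) u w :
  gprod h (u ++ w) = (gprod h u * gprod h w)%g.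
Proof. by elim: u => [|a u IH] /=; rewrite ?mul1g // IH mulgA. Qed.

Lemma gprod_foldl (gT : finGroupType) (h : A -> gT) w :
  foldl (fun g a => (g * h a)%g) 1%g w = gprod h w.
Proof.
rewrite -[RHS]mul1g; elim: w (1%g) => [|a w IH] g /=; first by rewrite mulg1.
by rewrite IH mulgA.
Qed.

Lemma gprod_inv (gT : finGroupType) (h : A -> gT) w :
  exists w', gprod h w' = (gprod h w)^-1%g.
Proof.
exists (wpow #[gprod h w]%g.-1 w); rewrite invg_expg.
by elim: _.-1 => [|n IH] //; rewrite wpowS gprod_cat IH expgS.
Qed.

Lemma prevariety_quotient_algebra (G : lang A -> Prop) :
  prevariety G -> quotient_algebra G.
Proof.
move=> [[_ GT GU _] Greg GC Gl Gr]; split=> //; first by move=> u L GL; split; auto.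
by move=> L /Greg; exact: finite_index_regular.
Qed.

(* The syntactic monoid of a group language, as a quotient of a recognizing group. *)
Lemma syntactic_group (G : lang A -> Prop) (L : lang A) :
  group_prevariety G -> G L -> exists (H : finGroupType) (al : A -> H),
  (forall P : H -> Prop, G (fun w => P (gprod al w))) /\
  forall w, gprod al w = 1%g -> L [::] -> L w.
Proof.
move=> [/prevariety_quotient_algebra Gq Ggrp] GL.
have [gT [h [F hF]]] := Ggrp _ GL.
have [M [f [[fc fD] fL]]] := syntactic_map Gq GL.
have fh u v : gprod h u = gprod h v -> f u = f v.
  by move=> e; apply/fL => x y; rewrite !hF !gprod_foldl !gprod_cat e.
(* The images of the words equivalent to the empty word. They form a subgroup normalized by the
   images of all words, which suffices for multiplying the cosets of words. *)
pose N0 := [set g | `[< exists2 w, gprod h w = g & f w = f [::] >]].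
have N0g : group_set N0.
  apply/group_setP; split; first by rewrite inE; apply/asboolP; exists [::].
  move=> g g'; rewrite !inE => /asboolP[w <- fw] /asboolP[w' <- fw'].
  apply/asboolP; exists (w ++ w'); first by rewrite gprod_cat.
  by rewrite (fc _ [::] _ [::]).
pose N := Group N0g.
have norm w : gprod h w \in 'N(N)%g.
  rewrite inE; apply/subsetP => _ /imsetP[g + ->]; rewrite !inE.
  move=> /asboolP[k <- fk]; have [w' e] := gprod_inv h w.
  apply/asboolP; exists (w' ++ k ++ w).
    by rewrite !gprod_cat e /conjg.
  have fkw : f (k ++ w) = f w by exact: (fc _ [::] _ w).
  have -> : f (w' ++ k ++ w) = f (w' ++ w) by exact: fc.
  by apply: fh; rewrite gprod_cat e mulVg.
pose al a := coset N (h a).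
have alE w : gprod al w = coset N (gprod h w).
  elim: w => [|a w IH] /=; first by rewrite (coset_id (group1 N)).
  by rewrite IH coset_morphM //; have := norm [:: a]; rewrite /= mulg1.
have al_f w w' : gprod al w = gprod al w' <-> f w = f w'.
  rewrite !alE; split.
    move=> /kercoset_rcoset[//|//|z]; rewrite inE => /asboolP[k <- fk] e.
    have -> : f w = f (k ++ w') by apply: fh; rewrite gprod_cat.
    by rewrite (fc _ [::] _ w').
  move=> e; apply/rcoset_kercosetP => //; rewrite mem_rcoset inE; apply/asboolP.
  have [v ev] := gprod_inv h w'; exists (w ++ v); first by rewrite gprod_cat ev.
  have -> : f (w ++ v) = f (w' ++ v) by exact: fc.
  by apply: fh; rewrite gprod_cat ev mulgV.
exists (coset_of N), al; split=> [P|w e L0].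
  rewrite (_ : (fun w => _) = fun w => exists2 w', f w' = f w & P (gprod al w')).
    exact: (fD (fun m => exists2 w', f w' = m & P (gprod al w'))).
  apply: lang_ext => w; split=> [Pw|[w' /al_f -> //]].
  by exists w.
have /fL/(_ [::] [::]) : f w = f [::] by apply/al_f; rewrite e.
by rewrite /= cats0 => ->.
Qed.

End GroupLanguages.

(** * The imprint lies inside every complete set *)

Section Completeness.
Variables (A : finType) (R : finPzSemiRingType) (G : lang A -> Prop)
  (rho : lang A -> R) (om : nat).
Hypotheses (addI : idempotent_add R) (om_gt0 : (0 < om)%N)
  (omI : forall r : R, r ^+ om * r ^+ om = r ^+ om) (Gg : group_prevariety G)
  (rhoR : rating_map rho) (rhoN : nice_rating rho) (rhoM : mult_rating rho).
Variable S : rset R.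
Hypothesis Sc : SF_complete G rho om S.

(** Each [r] outside [S] is avoided by some [G]-identity; as [R] is finite, intersecting these gives
    one identity that avoids them all. *)
Lemma iota_mu_attained :
  exists L, [/\ G L, L [::] & forall r, mu rho S L r -> S r].
Proof.
have [_ _ Siota _] := Sc; have [GT GU GC _ _] := prevariety_quotient_algebra (proj1 Gg).
have /choice[Lr hLr] r : exists L, [/\ G L, L [::] & ~ S r -> ~ mu rho S L r].
  have [Sr|nSr] := pselect (S r); first by exists (@lfull A).
  apply: contrapT => no; apply: nSr; apply: Siota => L GL L0; apply: contrapT => nm.
  by apply: no; exists L.
exists (fun w => forall r, r \in enum R -> Lr r w); split.
- by apply: bool_bigI => // r _; have [] := hLr r.
- by move=> r _; have [] := hLr r.
- move=> r [w [hw mw]]; apply: contrapT => /(let: And3 _ _ h := hLr r in h); apply.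
  by exists w; split=> //; apply: hw; rewrite mem_enum.
Qed.

Lemma SF_complete_one : S 1.
Proof. by have [L [_ L0 h]] := iota_mu_attained; apply: h; exists [::]. Qed.

(* Unlike [mu_word], this absorbs [S] on both sides even for the empty word. *)
Fixpoint nu_word (w : seq A) : rset R :=
  if w is a :: w' then
    fun r => exists s x, [/\ S s, nu_word w' x & r = s * rho (lword [:: a]) * x]
  else S.

Lemma nu_word_cat u w q r : nu_word u q -> nu_word w r -> nu_word (u ++ w) (q * r).
Proof.
have [_ SM _ _] := Sc.
elim: u q => [|a u IH] q /=.
  case: w => [|a w] /= Sq; first exact: SM.
  move=> [s [x [Ss nx ->]]]; exists (q * s), x.
  by split=> //; [exact: SM|rewrite !mulrA].
move=> [s [x [Ss nx ->]]] nr; exists s, (x * r); split=> //; first exact: IH.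
by rewrite !mulrA.
Qed.

(** Every letter but the last takes 1 as its right factor from [S]; the last letter also absorbs the
    trailing element of [S]. *)
Lemma nu_word_mu a w r : nu_word (a :: w) r -> mu_word rho S (a :: w) r.
Proof.
elim: w a r => [|b w IH] a r [s [x [Ss nx ->]]].
  by exists (s * rho (lword [:: a]) * x), 1; rewrite mulr1; split=> //; exists s, x.
exists (s * rho (lword [:: a]) * 1), x; rewrite mulr1; split; last by split=> //; exact: IH.
by exists s, 1; split=> //; split; [exact: SF_complete_one|rewrite mulr1].
Qed.

Lemma iota_SF_imprint_le r :
  iota_opt G (fun K => opt_imprint (SF G) K rho) r -> S r.
Proof.
move=> hr; have [Sdown SM _ Som] := Sc; have S1 := SF_complete_one.
have [L [GL L0 muL]] := iota_mu_attained.
have [H [al [Gal Lal]]] := syntactic_group Gg GL.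
pose T (p : R * H) := exists2 w, gprod al w = p.2 & nu_word w p.1.
(* The empty word contributes [S] itself; a nonempty word of degree 1 lies in [L], where [mu] stays
   inside [S]. *)
have TS q : T (q, 1%g) -> S q.
  move=> [[//|a w]] /Lal/(_ L0) Lw nw; apply: muL; exists (a :: w).
  by split=> //; exact: nu_word_mu.
have T1 : T (gone R H) by exists [::].
have TM p q : T p -> T q -> T (gmul p q).
  move=> [w ew nw] [w' ew' nw']; exists (w ++ w'); last exact: nu_word_cat.
  by rewrite gprod_cat ew ew'.
have Tom q : T (q, 1%g) -> T (q ^+ om + q ^+ om.+1, 1%g).
  by move=> /TS/Som Sq; exists [::].
pose v a : R * H := (rho (lword [:: a]), al a).
have wvalE w : wval v w = (rho (lword w), gprod al w).
  elim: w => [|a w IH] /=; first by rewrite (proj1 rhoM).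
  by rewrite IH -[a :: w]cat1s rating_word_cat.
(* With [d] the unit, the orbit is [T] itself. *)
have [|I [kap [u [fib uP uO]]]] :=
    graded_cover_exists addI om_gt0 omI T1 TM Tom (C := [set: A]) (v := v) (d := gone R H).
  move=> b _; exists (v b); last by rewrite gmul1 gone_mul.
  exists [:: b]; first by rewrite /= mulg1.
  by exists 1, 1; rewrite mulr1 mul1r.
have allT w : all (mem [set: A]) w by apply/allP => a _; rewrite inE.
pose fiber i : lang A := fun w => all (mem [set: A]) w /\ kap w = i.
(* Pieces without a word of degree 1 are discarded; in the others [u i] has degree 1, so its value
   lies in [S]. *)
pose is1 i := `[< exists2 w, kap w = i & gprod al w = 1%g >].
have cov : is_cover (SF G) (fun w => gprod al w = 1%g)
    (List.map fiber [seq i <- enum I | is1 i]).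
  split=> [_ /List.in_map_iff[i [<- _]]|w w1].
    apply: SF_mono (fib i) => _ [P ->]; apply: SF_base.
    rewrite (_ : (fun w => _) = fun w => P (gprod al w)); first exact: Gal.
    by apply: lang_ext => w; rewrite wvalE.
  exists (fiber (kap w)); split=> //; apply/List.in_map_iff; exists (kap w); split=> //.
  have : kap w \in [seq i <- enum I | is1 i].
    by rewrite mem_filter mem_enum andbT; apply/asboolP; exists w.
  by elim: [seq _ <- _ | _] => // i s IH; rewrite inE => /orP[/eqP->|/IH]; [left|right].
have [|//|_ [/List.in_map_iff[i [<- ini]] lei]] := hr (fun w => gprod al w = 1%g) _ _ _ cov.
  exact: (Gal (fun g => g = 1%g)).
have /andP[/asboolP[w0 k0 g0] _] : is1 i && (i \in enum I).
  rewrite -mem_filter.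
  elim: [seq _ <- _ | _] ini => // j s IH [->|/IH]; rewrite inE ?eqxx // => ->.
  by rewrite orbT.
have ui : T (u i).
  by have [t Tt] := uO i; rewrite gmul1 gone_mul => ->.
have ui1 : (u i).2 = 1%g.
  by have [_] := uP w0 (allT w0); rewrite wvalE k0 /= g0.
have Sui : S (u i).1 by apply: TS; rewrite -ui1; case: (u i) ui.
apply: Sdown Sui _; apply: rle_trans lei _.
apply: rating_le_of_words => // w [wT <-].
by have [] := uP w wT; rewrite wvalE.
Qed.

End Completeness.

Theorem theorem10p6 (A : finType) (R : finPzSemiRingType)
  (G : lang A -> Prop) (rho : lang A -> R) (om : nat) :
  idempotent_add R ->
  (0 < om)%N ->
  (forall r : R, r ^+ om * r ^+ om = r ^+ om) ->
  group_prevariety G ->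
  rating_map rho -> nice_rating rho -> mult_rating rho ->
  least_SF_complete G rho om
    (iota_opt G (fun K => opt_imprint (SF G) K rho)).
Proof.
move=> addI om_gt0 omI Gg rhoR rhoN rhoM; split.
  apply: SF_imprint_complete => //.
  by case: Gg => /prevariety_quotient_algebra.
by move=> S' Sc r; apply: iota_SF_imprint_le Sc r.
Qed.
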